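(* Let $\mathbb{K}=(G,M,I,\preceq)$ be an extended formal context whose partial order is valid, i.e. $\underline{A'}=(\underline{A'})''$ for every $A\subseteq M$. Then the meet (greatest common sub-concept) in the concept lattice of $(G,M,I)$ of any two typical concepts of $\mathbb{K}$ is itself a typical concept. Hence the set of typical concepts forms a $\wedge$-subsemilattice of the concept lattice.
   Context: An extended formal context is $(G,M,I,\preceq)$ with $G$ a finite non-empty set of objects, $M$ a finite non-empty set of attributes, $I\subseteq G\times M$, and $\preceq$ a partial order on $G$ with strict part $\prec$. Derivation: for $B\subseteq M$, $B'=\{g\in G\mid\forall m\in B,\ (g,m)\in I\}$; for $A\subseteq G$, $A'=\{m\in M\mid\forall g\in A,\ (g,m)\in I\}$. A formal concept is a pair $(A,B)$ with $A'=B$, $B'=A$; concepts are ordered by $(A_1,B_1)\le(A_2,B_2)$ iff $A_1\subseteq A_2$, forming the concept lattice, in which the meet is $(A_1,B_1)\wedge(A_2,B_2)=(A_1\cap A_2,(B_1\cup B_2)'')$. Minimised derivation: $\underline{B'}=\{g\in B'\mid\nexists h\in B'\text{ with } h\prec g\}$. A typical concept is a pair $\big((\underline{X'})'',(\underline{X'})'\big)$ for some $X\subseteq M$. *)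

(* Defs.v *)
From HB Require Import structures.
From mathcomp Require Import all_boot all_order.

Set Implicit Arguments.
Unset Strict Implicit.
Unset Printing Implicit Defensive.

Import Order.TTheory.

Definition extent_of (G M : finType) (I : {set G * M}) (B : {set M}) : {set G} :=
  [set g : G | [forall m in B, (g, m) \in I]].

Definition intent_of (G M : finType) (I : {set G * M}) (A : {set G}) : {set M} :=
  [set m : M | [forall g in A, (g, m) \in I]].

Definition is_concept (G M : finType) (I : {set G * M})
    (C : {set G} * {set M}) : bool :=
  (intent_of I C.1 == C.2) && (extent_of I C.2 == C.1).

Record concept (G M : finType) (I : {set G * M}) := Concept {
  concept_val :> {set G} * {set M};
  conceptP : is_concept I concept_val
}.

HB.instance Definition _ (G M : finType) (I : {set G * M}) :=
  [isSub for @concept_val G M I].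
HB.instance Definition _ (G M : finType) (I : {set G * M}) :=
  [Finite of concept I by <:].

Definition extent (G M : finType) (I : {set G * M}) (C : concept I) : {set G} :=
  (concept_val C).1.

Definition intent (G M : finType) (I : {set G * M}) (C : concept I) : {set M} :=
  (concept_val C).2.

Lemma galois (G M : finType) (I : {set G * M}) (A : {set G}) (B : {set M}) :
  (A \subset extent_of I B) = (B \subset intent_of I A).
Proof.
apply/subsetP/subsetP => h x xin; rewrite inE; apply/forall_inP => y yin.
  by have := h y yin; rewrite inE => /forall_inP/(_ x xin).
by have := h y yin; rewrite inE => /forall_inP/(_ x xin).
Qed.

Lemma sub_extent_intent (G M : finType) (I : {set G * M}) (A : {set G}) :
  A \subset extent_of I (intent_of I A).
Proof. by rewrite galois. Qed.

Lemma sub_intent_extent (G M : finType) (I : {set G * M}) (B : {set M}) :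
  B \subset intent_of I (extent_of I B).
Proof. by rewrite -galois. Qed.

Lemma intent_of_extent_of_intent_of (G M : finType) (I : {set G * M})
    (A : {set G}) :
  intent_of I (extent_of I (intent_of I A)) = intent_of I A.
Proof.
apply/eqP; rewrite eqEsubset sub_intent_extent andbT -galois.
exact: subset_trans (sub_extent_intent I A) (sub_extent_intent I _).
Qed.

Lemma extent_of_intent_of_extent_of (G M : finType) (I : {set G * M})
    (B : {set M}) :
  extent_of I (intent_of I (extent_of I B)) = extent_of I B.
Proof.
apply/eqP; rewrite eqEsubset sub_extent_intent andbT galois.
exact: subset_trans (sub_intent_extent I B) (sub_intent_extent I _).
Qed.

Lemma intent_ofU (G M : finType) (I : {set G * M}) (A1 A2 : {set G}) :
  intent_of I (A1 :|: A2) = intent_of I A1 :&: intent_of I A2.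
Proof.
by apply/setP => m; rewrite in_setI -!sub1set -!galois subUset.
Qed.

Lemma extent_ofU (G M : finType) (I : {set G * M}) (B1 B2 : {set M}) :
  extent_of I (B1 :|: B2) = extent_of I B1 :&: extent_of I B2.
Proof.
by apply/setP => g; rewrite in_setI -!sub1set !galois subUset.
Qed.

Lemma intent_of_extent (G M : finType) (I : {set G * M}) (C : concept I) :
  intent_of I (extent C) = intent C.
Proof. by case/andP: (conceptP C) => /eqP. Qed.

Lemma extent_of_intent (G M : finType) (I : {set G * M}) (C : concept I) :
  extent_of I (intent C) = extent C.
Proof. by case/andP: (conceptP C) => _ /eqP. Qed.

Lemma extent_inj (G M : finType) (I : {set G * M}) :
  injective (@extent G M I).
Proof.
move=> C1 C2 eqC; apply: val_inj => /=.
rewrite (surjective_pairing (concept_val C1)) (surjective_pairing (concept_val C2)).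
rewrite -!/(extent _) -!/(intent _).
by rewrite -!intent_of_extent eqC.
Qed.

Fact concept_meet_subproof (G M : finType) (I : {set G * M})
    (C1 C2 : concept I) :
  is_concept I (extent C1 :&: extent C2,
                intent_of I (extent_of I (intent C1 :|: intent C2))).
Proof.
have e : extent_of I (intent C1 :|: intent C2) = extent C1 :&: extent C2.
  by rewrite extent_ofU !extent_of_intent.
by rewrite /is_concept /= extent_of_intent_of_extent_of e !eqxx.
Qed.

Definition concept_meet (G M : finType) (I : {set G * M})
    (C1 C2 : concept I) : concept I :=
  Concept (concept_meet_subproof C1 C2).

Fact concept_join_subproof (G M : finType) (I : {set G * M})
    (C1 C2 : concept I) :
  is_concept I (extent_of I (intent_of I (extent C1 :|: extent C2)),
                intent C1 :&: intent C2).
Proof.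
have e : intent_of I (extent C1 :|: extent C2) = intent C1 :&: intent C2.
  by rewrite intent_ofU !intent_of_extent.
by rewrite /is_concept /= intent_of_extent_of_intent_of e !eqxx.
Qed.

Definition concept_join (G M : finType) (I : {set G * M})
    (C1 C2 : concept I) : concept I :=
  Concept (concept_join_subproof C1 C2).

Definition concept_le (G M : finType) (I : {set G * M}) : rel (concept I) :=
  fun C1 C2 => extent C1 \subset extent C2.

Fact concept_le_refl (G M : finType) (I : {set G * M}) :
  reflexive (@concept_le G M I).
Proof. by move=> C; apply: subxx. Qed.

Fact concept_le_anti (G M : finType) (I : {set G * M}) :
  antisymmetric (@concept_le G M I).
Proof. by move=> C1 C2 h; apply: extent_inj; apply/eqP; rewrite eqEsubset. Qed.

Fact concept_le_trans (G M : finType) (I : {set G * M}) :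
  transitive (@concept_le G M I).
Proof. by move=> C2 C1 C3; apply: subset_trans. Qed.

Fact concept_display : Order.disp_t. Proof. exact: (Order.Disp tt tt). Qed.

HB.instance Definition _ (G M : finType) (I : {set G * M}) :=
  Order.Le_isPOrder.Build concept_display (concept I)
    (@concept_le_refl G M I) (@concept_le_anti G M I) (@concept_le_trans G M I).

Fact concept_meetP (G M : finType) (I : {set G * M}) (x y z : concept I) :
  (x <= concept_meet y z)%O = (x <= y)%O && (x <= z)%O.
Proof. exact: subsetI. Qed.

Fact concept_joinP (G M : finType) (I : {set G * M}) (x y z : concept I) :
  (concept_join x y <= z)%O = (x <= z)%O && (y <= z)%O.
Proof.
rewrite /Order.le /= /concept_le {1}/extent /= -(extent_of_intent z).
by rewrite galois intent_of_extent_of_intent_of -galois subUset.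
Qed.

HB.instance Definition _ (G M : finType) (I : {set G * M}) :=
  Order.POrder_MeetJoin_isLattice.Build concept_display (concept I)
    (@concept_meetP G M I) (@concept_joinP G M I).

Definition min_extent_of (d : Order.disp_t) (G : finPOrderType d) (M : finType)
    (I : {set G * M}) (B : {set M}) : {set G} :=
  [set g in extent_of I B | ~~ [exists h in extent_of I B, (h < g)%O]].

Definition valid_order (d : Order.disp_t) (G : finPOrderType d) (M : finType)
    (I : {set G * M}) : Prop :=
  forall A : {set M},
    min_extent_of I A = extent_of I (intent_of I (min_extent_of I A)).

Definition typical (d : Order.disp_t) (G : finPOrderType d) (M : finType)
    (I : {set G * M}) (C : {set G} * {set M}) : bool :=
  [exists X : {set M},
    C == (extent_of I (intent_of I (min_extent_of I X)),
          intent_of I (min_extent_of I X))].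

Definition typical_concepts (d : Order.disp_t) (G : finPOrderType d)
    (M : finType) (I : {set G * M}) : {set concept I} :=
  [set C : concept I | typical I (concept_val C)].

(* Closure is under binary meets only: the top concept (G, G') is typical only
   when some minimised derivation is all of G. *)
Definition meet_subsemilattice (d : Order.disp_t) (L : finLatticeType d)
    (S : {set L}) : Prop :=
  S != set0 /\ {in S &, forall x y : L, (x `&` y)%O \in S}.

(* Main.v *)
Require Import Defs.
From mathcomp Require Import all_boot all_order.

Import Order.TTheory.

(** When the order is valid, a concept is typical exactly when its extent is an
    antichain: the extent of a typical concept is then a set of minimal
    elements, and conversely a concept whose extent is an antichain is the
    typical concept generated by its own intent. Since a subset of an antichain
    is an antichain, every sub-concept of a typical concept is typical. *)

Lemma typical_antichainP (d : Order.disp_t) (G : finPOrderType d) (M : finType)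
    (I : {set G * M}) (I_valid : valid_order I) (C : concept I) :
  reflect {in extent C &, forall g h : G, ~~ (h < g)%O} (typical I C).
Proof.
apply: (iffP existsP) => [[X /eqP eqC] g h | antiC].
  (* Validity removes the double-prime closure, so the extent of [C] is exactly the set of minimal
     elements of [extent_of I X]. *)
  rewrite /extent eqC /= -I_valid !inE => /andP[_ /exists_inPn min_g].
  by case/andP=> Xh _; apply: min_g; rewrite inE.
exists (intent C).
have -> : min_extent_of I (intent C) = extent C.
  apply/setP=> g; rewrite inE extent_of_intent.
  apply: andb_idr => Cg; apply/exists_inPn => h Ch; exact: antiC.
by rewrite intent_of_extent extent_of_intent -surjective_pairing.
Qed.

Arguments typical_antichainP {d G M I} I_valid {C}.

Lemma typical_le (d : Order.disp_t) (G : finPOrderType d) (M : finType)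
    (I : {set G * M}) (I_valid : valid_order I) (C1 C2 : concept I) :
  (C1 <= C2)%O -> typical I C2 -> typical I C1.
Proof.
move=> /subsetP sC12 /(typical_antichainP I_valid) antiC2.
by apply/(typical_antichainP I_valid) => g h /sC12 C2g /sC12; apply: antiC2.
Qed.

Lemma typical_concepts_neq0 (d : Order.disp_t) (G : finPOrderType d)
    (M : finType) (I : {set G * M}) : typical_concepts I != set0.
Proof.
(* Every attribute set generates a typical concept; [set0] is an arbitrary choice. *)
pose B := intent_of I (min_extent_of I set0).
have conceptB : is_concept I (extent_of I B, B).
  by rewrite /is_concept /= intent_of_extent_of_intent_of !eqxx.
apply/set0Pn; exists (Concept conceptB); rewrite inE.
by apply/existsP; exists set0.
Qed.

Theorem theorem4 (d : Order.disp_t) (G : finPOrderType d) (M : finType)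
    (I : {set G * M}) (G_gt0 : 0 < #|G|) (M_gt0 : 0 < #|M|)
    (I_valid : valid_order I) :
  (forall C1 C2 : concept I,
     typical I C1 -> typical I C2 -> typical I (C1 `&` C2)%O) /\
  meet_subsemilattice (typical_concepts I).
Proof.
have typicalI (C1 C2 : concept I) :
    typical I C1 -> typical I C2 -> typical I (C1 `&` C2)%O.
  (* The meet lies below [C1] and inherits typicality from it. *)
  by move=> typC1 _; apply: typical_le typC1; rewrite // leIl.
split=> //; split; first exact: typical_concepts_neq0.
by move=> C1 C2; rewrite !inE; apply: typicalI.
Qed.
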